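(* Let $g=2k-1$ or $g=2k$, with $k\ge 2$. The number of $\mathfrak{S}_{2g+2}$-orbits of spin structures of $\Sigma_g$ is at most $k+1$.
   Context: $\Sigma_g$ is a compact connected oriented surface of genus $g$, and $\alpha_1,\dots,\alpha_g,\beta_1,\dots,\beta_g$ is a symplectic basis of $H_1(\Sigma_g,\mathbb{Z}/2)$, i.e. $\alpha_i\cdot\beta_j=\delta_{ij}$, $\alpha_i\cdot\alpha_j=\beta_i\cdot\beta_j=0$ for the mod 2 intersection number. A spin structure is a map $c:H_1(\Sigma_g,\mathbb{Z}/2)\to\mathbb{Z}/2$ with $c(x+y)=c(x)+c(y)+x\cdot y$ for all $x,y$; $\mathcal{C}$ is the set of spin structures. For $\gamma\in H_1(\Sigma_g,\mathbb{Z}/2)$ let $T_\gamma(x)=x+(x\cdot\gamma)\gamma$, an element of the group $Sp_{2g}(\mathbb{Z}/2)$ of automorphisms preserving the intersection number. Let $\sigma_i=(i,i+1)\in\mathfrak{S}_{2g+2}$, $1\le i\le 2g+1$, where $\mathfrak{S}_n$ is the symmetric group. The group $\mathfrak{S}_{2g+2}$ acts through the homomorphism $\iota:\mathfrak{S}_{2g+2}\to Sp_{2g}(\mathbb{Z}/2)$ determined by $\iota(\sigma_1)=T_{\beta_1}$, $\iota(\sigma_{2g+1})=T_{\beta_g}$, $\iota(\sigma_{2i})=T_{\alpha_i}$ ($1\le i\le g$), $\iota(\sigma_{2j+1})=T_{\beta_j+\beta_{j+1}}$ ($1\le j\le g-1$). It acts on $\mathcal{C}$ from the right by $c\circ\sigma:=c\circ\iota(\sigma)$.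 *)

(* Defs.v *)
From HB Require Import structures.
From mathcomp Require Import all_boot all_order all_fingroup all_algebra.
From mathcomp Require Import all_solvable all_field.

Set Implicit Arguments.
Unset Strict Implicit.
Unset Printing Implicit Defensive.

Import GRing.Theory.
Local Open Scope ring_scope.

(* A finite-dimensional F_2-vector space V with a symmetric bilinear form and a
   symplectic basis stands for H_1(Sigma_g, Z/2) with the mod 2 intersection
   number.  [finvect_type V] is V itself, with its finType structure. *)

Definition symplectic_basis (V : vectType 'F_2) (dot : V -> V -> 'F_2) (g : nat)
    (alpha beta : 'I_g -> V) : Prop :=
  [/\ basis_of fullv (codom alpha ++ codom beta),
      forall i j, dot (alpha i) (beta j) = (i == j)%:R,
      forall i j, dot (alpha i) (alpha j) = 0 &
      forall i j, dot (beta i) (beta j) = 0].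

Definition transvection (V : vectType 'F_2) (dot : V -> V -> 'F_2) (gamma x : V)
    : V :=
  x + dot x gamma *: gamma.

Definition Sp (V : vectType 'F_2) (dot : V -> V -> 'F_2)
    : {set {perm finvect_type V}} :=
  [set f : {perm finvect_type V} |
    [forall a : 'F_2, forall x, forall y, f (a *: x + y) == a *: f x + f y]
    && [forall x, forall y, dot (f x) (f y) == dot x y]].

Definition spin_structures (V : vectType 'F_2) (dot : V -> V -> 'F_2)
    : {set {ffun finvect_type V -> 'F_2}} :=
  [set c : {ffun finvect_type V -> 'F_2} |
    [forall x, forall y, c (x + y) == c x + c y + dot x y]].

(* The transposition (i, i+1) of {1, ..., n+1}, for 1 <= i <= n; the point p of
   {1, ..., n+1} is coded by p - 1 : 'I_n.+1. *)
Definition sigma (n i : nat) : 'S_n.+1 := tperm (inord i.-1) (inord i).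

(* With 0-based indices, alpha_i and beta_i of the usual 1-based notation are
   [alpha i'] and [beta i'] with i = i'.+1.  The product of permutations is
   composition in diagrammatic order both in 'S_n and in {perm V}, so a morphism
   for it is the same as a morphism for right-to-left composition. *)
Definition hyperelliptic_morphism (V : vectType 'F_2) (dot : V -> V -> 'F_2)
    (g : nat) (alpha beta : 'I_g -> V)
    (io : {morphism [set: 'S_(2 * g).+2] >-> {perm finvect_type V}}) : Prop :=
  let s := sigma (2 * g).+1 in
  let T := transvection dot in
  [/\ forall p, io p \in Sp dot,
      forall i : 'I_g, i = 0%N :> nat -> io (s 1%N) =1 T (beta i),
      forall i : 'I_g, i.+1 = g -> io (s (2 * g).+1) =1 T (beta i),
      forall i : 'I_g, io (s (2 * i.+1)%N) =1 T (alpha i) &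
      forall i j : 'I_g, j = i.+1 :> nat ->
        io (s (2 * i.+1).+1) =1 T (beta i + beta j)].

Definition spin_act (V : vectType 'F_2) (n : nat)
    (io : {morphism [set: 'S_n] >-> {perm finvect_type V}})
    (c : {ffun finvect_type V -> 'F_2}) (p : 'S_n)
    : {ffun finvect_type V -> 'F_2} :=
  [ffun x => c (io p x)].

Definition spin_orbits (V : vectType 'F_2) (dot : V -> V -> 'F_2) (n : nat)
    (io : {morphism [set: 'S_n] >-> {perm finvect_type V}})
    : {set {set {ffun finvect_type V -> 'F_2}}} :=
  [set [set spin_act io c p | p : 'S_n] | c in spin_structures dot].

(* Main.v *)
Require Import Defs.
From mathcomp Require Import all_boot all_order all_fingroup all_algebra.
From mathcomp Require Import all_solvable all_field.
From mathcomp Require Import zify.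
Import GRing.Theory.
Local Open Scope ring_scope.

(** The classes beta_1, alpha_1, beta_1 + beta_2, alpha_2, ..., alpha_g, beta_g
    form a chain gamma_1, ..., gamma_(2g+1) in which only consecutive members
    meet.  A spin structure c is determined by its values on the chain, which
    can be written c(gamma_i) = 1 + s_i + s_(i+1) for a 2-colouring s of the
    2g+2 points, unique up to complement.  As c(T_gamma(x)) = c(x) +
    (1 + c(gamma)) (x . gamma), the transvection along gamma_i exchanges s_i
    and s_(i+1), so the symmetric group permutes colourings naturally, and the
    orbit of c depends only on the number w of points of colour 1, up to
    w -> 2g+2-w.  The relation
    gamma_1 + gamma_3 + ... + gamma_(2g+1) = 0 forces w = g+1 mod 2, which
    leaves w = g+1-2i with 0 <= i <= (g+1)/2. *)

(** * Arithmetic in F_2 through booleans *)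

Lemma F2E (a : 'F_2) : a = (a != 0)%:R.
Proof. by apply/val_inj; case: a => [[|[|m]] Hm]. Qed.

Lemma F2_addb (a b : bool) : a%:R + b%:R = (a (+) b)%:R :> 'F_2.
Proof. by apply/val_inj; case: a b => [] []. Qed.

Lemma F2_natb_inj (a b : bool) : a%:R = b%:R :> 'F_2 -> a = b.
Proof. by case: a b => [] []. Qed.

Lemma F2_natr (m : nat) : m%:R = (odd m)%:R :> 'F_2.
Proof.
by elim: m => // m IHm; rewrite -natr1 IHm -[1]/(true%:R) F2_addb addbT.
Qed.

Lemma F2_addrr (a : 'F_2) : a + a = 0.
Proof. by rewrite [a]F2E F2_addb addbb. Qed.

(** * Adjacent transpositions and rearrangement of 2-colourings *)

Lemma eq_inord (n i j : nat) :
  (i <= n)%N -> (j <= n)%N -> (inord i == inord j :> 'I_n.+1) = (i == j).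
Proof. by move=> hi hj; rewrite -val_eqE /= !inordK. Qed.

(** Conjugating (i, i+d+1) by (i+d+1, i+d+2) gives (i, i+d+2), so the adjacent transpositions yield
    all transpositions, hence the whole group. *)
Lemma adjacent_tperm_ind (n : nat) (P : 'S_n.+1 -> Prop) :
  P 1%g -> (forall p q, P p -> P q -> P (p * q)%g) ->
  (forall i, (i < n)%N -> P (sigma n i.+1)) -> forall p, P p.
Proof.
move=> P1 PM Ps.
have Plt d i : (i + d.+1 <= n)%N -> P (tperm (inord i) (inord (i + d.+1))).
  elim: d i => [|d IHd] i hid; first by rewrite addn1 in hid *; apply: Ps.
  have hs := Ps (i + d.+1)%N ltac:(lia).
  have -> : tperm (inord i) (inord (i + d.+2)) =
      (tperm (inord i) (inord (i + d.+1)) ^ sigma n (i + d.+1).+1)%g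
      :> 'S_n.+1.
    rewrite tpermJ /sigma /= tpermD ?tpermL -?addnS // eq_inord; lia.
  rewrite /conjg; apply: (PM); last by apply: (PM) => //; apply: IHd; lia.
  by rewrite /sigma tpermV.
have Pt x y : P (tperm x y).
  wlog lexy : x y / (x <= y)%N.
    by move=> W; case/orP: (leq_total x y) => /W //; rewrite tpermC.
  have [->|nxy] := eqVneq x y; first by rewrite tperm1.
  have ltxy : (x < y)%N by rewrite ltn_neqAle lexy andbT.
  have := Plt (y - x.+1)%N x; rewrite addnS -addSn subnKC // !inord_val.
  by apply; rewrite -ltnS.
move=> p; have [ts -> _] := prod_tpermP p.
elim: ts => [|t ts IH]; first by rewrite big_nil.
by rewrite big_cons; apply: (PM).
Qed.

Lemma eq_count_perm (n : nat) (s s' : 'I_n -> bool) :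
  #|[pred i | s i]| = #|[pred i | s' i]| -> exists p : 'S_n, s' =1 s \o p.
Proof.
move=> es.
have count_codom (u : 'I_n -> bool) :
    count_mem true [tuple u i | i < n] = #|[pred i | u i]|.
  rewrite /= count_map cardE size_filter enumT.
  by apply: eq_count => i /=; rewrite -topredE /= eqb_id.
have: perm_eq [tuple s' i | i < n] [tuple s i | i < n].
  apply/allP => b _ /=; apply/eqP.
  case: b; first by rewrite !count_codom.
  have countF (u : 'I_n -> bool) :
      count_mem false [tuple u i | i < n] = (n - #|[pred i | u i]|)%N.
    rewrite -count_codom -[X in (X - _)%N](size_tuple [tuple u i | i < n]).
    rewrite -(count_predC (pred1 true)) addKn.
    by apply: eq_count => -[].
  by rewrite !countF es.
case/tuple_permP => p hp; exists p => i /=.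
have /(congr1 (fun t => tnth t i)) :
    [tuple s' i | i < n] = [tuple tnth [tuple s i | i < n] (p i) | i < n].
  exact: val_inj.
by rewrite !tnth_mktuple.
Qed.

(** * Spin structures and colourings along a chain *)

Section Chain.

Variables (V : vectType 'F_2) (dot : {symmetric V}) (n : nat) (gam : nat -> V).
Variable io : {morphism [set: 'S_n.+1] >-> {perm finvect_type V}}.

Hypothesis dot_gam : forall i j, (i < n)%N -> (j < n)%N ->
  dot (gam i) (gam j) = ((i == j.+1) || (j == i.+1))%:R.
Hypothesis io_Sp : forall p, io p \in Sp dot.
Hypothesis io_gam : forall i, (i < n)%N ->
  io (sigma n i.+1) =1 transvection dot (gam i).

Implicit Types (c : {ffun finvect_type V -> 'F_2}) (s : 'I_n.+1 -> bool).

Lemma spinD c (x y : V) : c \in spin_structures dot ->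
  c (x + y) = c x + c y + dot x y.
Proof. by rewrite inE => /forallP/(_ x)/forallP/(_ y)/eqP. Qed.

Lemma spin0 c : c \in spin_structures dot -> c 0 = 0.
Proof.
move=> /(spinD c 0 0); rewrite addr0 linear0l addr0.
by move/eqP; rewrite -[X in X == _]addr0 (inj_eq (addrI _)) => /eqP.
Qed.

Lemma spin_act_spin c p :
  c \in spin_structures dot -> spin_act io c p \in spin_structures dot.
Proof.
move=> hc; rewrite inE; apply/forallP => x; apply/forallP => y.
have := io_Sp p; rewrite inE => /andP[].
move=> /forallP/(_ 1)/forallP/(_ x)/forallP/(_ y).
rewrite !scale1r => /eqP ioD /forallP/(_ x)/forallP/(_ y)/eqP iodot.
by rewrite !ffunE ioD spinD // iodot.
Qed.

(** The factors reverse because [p * q] applies [p] first; for right-to-left composition this is the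
    right action. *)
Lemma spin_actM c p q :
  spin_act io c (p * q)%g = spin_act io (spin_act io c q) p.
Proof. by apply/ffunP => x; rewrite !ffunE morphM ?inE // permM. Qed.

Lemma spin_act1 c : spin_act io c 1%g = c.
Proof. by apply/ffunP => x; rewrite !ffunE morph1 perm1. Qed.

Lemma spin_orbit_act c p :
  [set spin_act io (spin_act io c p) q | q : 'S_n.+1] =
  [set spin_act io c q | q : 'S_n.+1].
Proof.
apply/setP => d; apply/imsetP/imsetP => -[q _ ->].
  by exists (q * p)%g; rewrite ?spin_actM.
by exists (q * p^-1)%g; rewrite // -spin_actM mulgKV.
Qed.

(** The boolean equality encodes 1 + s_i + s_(i+1). *)
Definition labelling c s := forall i, (i < n)%N ->
  c (gam i) = (s (inord i) == s (inord i.+1))%:R.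

Lemma labelling_exists c : exists s, labelling c s.
Proof.
(* The colouring starts with [false] and switches from [i] to [i.+1] exactly when [c (gam i)] is
   0. *)
exists (fun i => odd (count (fun j => c (gam j) == 0) (iota 0 i))) => i hi.
rewrite !inordK // ?ltnS; last exact: ltnW.
have -> : iota 0 i.+1 = iota 0 i ++ [:: i] by rewrite -addn1 iotaD add0n.
rewrite count_cat oddD /= addn0 oddb.
rewrite [LHS]F2E; congr _%:R.
by case: (odd _); case: (_ == 0).
Qed.

Lemma labelling_compl c s : labelling c s -> labelling c (negb \o s).
Proof. by move=> h i /h ->; rewrite /= (inj_eq negb_inj). Qed.

(** Only the chain neighbours [j] of [i] are affected: [c (gam j)] gains c(gam_i) + 1 = s_i +
    s_(i+1), which trades the point shared by the edges [i] and [j] for the other end of [i]. *)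
Lemma labelling_sigma c s i : (i < n)%N -> c \in spin_structures dot ->
  labelling c s -> labelling (spin_act io c (sigma n i.+1)) (s \o sigma n i.+1).
Proof.
move=> hi hc hs j hj.
rewrite ffunE io_gam // /transvection dot_gam //= /sigma /=.
have [->|nij] := eqVneq j i.
  rewrite !ltn_eqF // scale0r addr0 hs // tpermL tpermR.
  by rewrite eq_sym.
have [ej|nj] := eqVneq j i.+1.
  subst j; rewrite /= scale1r spinD // dot_gam // eqxx /= !hs //.
  rewrite tpermR tpermD ?eq_inord; try lia.
  by rewrite -[1]/(true%:R) !F2_addb; do 3 case: (s _).
have [ei|ni] := eqVneq i j.+1.
  subst i; rewrite /= scale1r spinD // dot_gam // eqxx orbT !hs //.
  rewrite tpermL tpermD ?eq_inord; try lia.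
  by rewrite -[1]/(true%:R) !F2_addb; do 3 case: (s _).
rewrite /= scale0r addr0 hs // !tpermD ?eq_inord //; lia.
Qed.

Lemma labelling_perm p c s : c \in spin_structures dot ->
  labelling c s -> labelling (spin_act io c p) (s \o p).
Proof.
move: p c s.
apply: adjacent_tperm_ind => [c s _ hs i hi|p q IHp IHq c s hc hs|].
- by rewrite spin_act1 hs //= !perm1.
- rewrite spin_actM => i hi; rewrite (IHp _ (s \o q)) //=.
  + by rewrite !permM.
  + exact: spin_act_spin.
  + exact: IHq.
- by move=> i hi c s; apply: labelling_sigma.
Qed.

(** A permutation matching the colourings carries [c] to a spin structure with the chain values of
    [c']; the first hypothesis, that the chain separates spin structures, identifies the two. *)
Lemma labelling_orbit c c' s s' :
  (forall d d', d \in spin_structures dot -> d' \in spin_structures dot ->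
     (forall i, (i < n)%N -> d (gam i) = d' (gam i)) -> d = d') ->
  c \in spin_structures dot -> c' \in spin_structures dot ->
  labelling c s -> labelling c' s' ->
  #|[pred i | s i]| = #|[pred i | s' i]| -> exists p, c' = spin_act io c p.
Proof.
move=> gam_ext hc hc' hs hs' /eq_count_perm[p hp]; exists p.
apply: gam_ext => // [|i hi]; first exact: spin_act_spin.
by rewrite hs' // (labelling_perm p c s) // !hp.
Qed.

End Chain.

Lemma leq_card_imset_factor (T T' I : finType) (f : T -> T') (h : T -> I)
    (A : {set T}) :
  {in A &, forall x y, h x = h y -> f x = f y} -> (#|f @: A| <= #|I|)%N.
Proof.
move=> fh; rewrite -(card_imset _ (@Some_inj _)) -[leqRHS]cardsT.
(* One preimage under [h] is chosen for each index; [None] covers the indices not attained on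
   [A]. *)
pose F i := omap f [pick x in A | h x == i].
apply: leq_trans (leq_imset_card F _); apply/subset_leq_card/subsetP.
move=> _ /imsetP[_ /imsetP[x xA ->] ->]; apply/imsetP; exists (h x) => //.
rewrite /F; case: pickP => [y /andP[yA /eqP hyx]|/(_ x)]; last first.
  by rewrite xA eqxx.
by rewrite /= (fh y x).
Qed.

(** * The chain built from a symplectic basis *)

Section HyperellipticChain.

Variables (V : vectType 'F_2) (dot : {symmetric V}) (g : nat).
Variables alpha beta : 'I_g -> V.
Hypothesis hab : symplectic_basis dot alpha beta.

Definition extend0 (v : 'I_g -> V) (m : nat) : V := oapp v 0 (insub m).

(* [chain i] is the class whose transvection is the image of [sigma i.+1];
   [extend0] makes the end cases beta_1 and beta_g instances of
   beta_j + beta_(j+1). *)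
Definition chain (i : nat) : V :=
  if odd i then extend0 alpha i./2
  else (if i./2 is m.+1 then extend0 beta m else 0) + extend0 beta i./2.

Lemma extend0E v (i : 'I_g) : extend0 v i = v i.
Proof. by rewrite /extend0 valK. Qed.

Lemma extend0_lt v m (hm : (m < g)%N) : extend0 v m = v (Ordinal hm).
Proof. exact: (extend0E v (Ordinal hm)). Qed.

Lemma extend0_ge v m : (g <= m)%N -> extend0 v m = 0.
Proof. by move=> h; rewrite /extend0 insubF // ltnNge h. Qed.

Lemma extend0P (Q : V -> nat -> Prop) v :
  (forall i : 'I_g, Q (v i) i) -> (forall m, (g <= m)%N -> Q 0 m) ->
  forall m, Q (extend0 v m) m.
Proof.
move=> hv h0 m; have [lm|/[dup] /extend0_ge-> /h0 //] := ltnP m g.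
by rewrite -[m]/(val (Ordinal lm)) extend0E.
Qed.

Lemma dot_sym x y : dot x y = dot y x.
Proof. by rewrite hermC /= mul1r. Qed.

Lemma dot_alpha m l : dot (extend0 alpha m) (extend0 alpha l) = 0.
Proof.
have [_ _ aa _] := hab.
apply: (extend0P (fun x _ => dot x _ = 0)) => [i|? _]; last exact: linear0l.
apply: (extend0P (fun x _ => dot _ x = 0)) => [j|? _]; last exact: linear0r.
exact: aa.
Qed.

Lemma dot_beta m l : dot (extend0 beta m) (extend0 beta l) = 0.
Proof.
have [_ _ _ bb] := hab.
apply: (extend0P (fun x _ => dot x _ = 0)) => [i|? _]; last exact: linear0l.
apply: (extend0P (fun x _ => dot _ x = 0)) => [j|? _]; last exact: linear0r.
exact: bb.
Qed.

(** For [l >= g] both sides vanish; the bound on [m] excludes [m = l >= g], where the left side is 0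
    and the right side 1. *)
Lemma dot_alpha_beta m l : (m < g)%N ->
  dot (extend0 alpha m) (extend0 beta l) = (m == l)%:R.
Proof.
move=> hm; have [_ ab _ _] := hab; rewrite extend0_lt.
apply: (extend0P (fun x l => dot _ x = (_ == l)%:R)) => [j|l' hl] /=.
  by rewrite ab.
by rewrite linear0r ltn_eqF // (leq_trans hm hl).
Qed.

Lemma chain_odd m : chain m.*2.+1 = extend0 alpha m.
Proof. by rewrite /chain /= odd_double /= uphalf_double. Qed.

Lemma chain_even m : chain m.*2 =
  (if m is l.+1 then extend0 beta l else 0) + extend0 beta m.
Proof. by rewrite /chain odd_double doubleK. Qed.

Lemma dot_chain_odd_even m l : (m < g)%N ->
  dot (chain m.*2.+1) (chain l.*2) = ((l == m) || (l == m.+1))%:R.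
Proof.
move=> hm; rewrite chain_odd chain_even linearDr /= dot_alpha_beta //.
rewrite [m == l]eq_sym; case: l => [|l]; first by rewrite linear0r add0r orbF.
rewrite dot_alpha_beta // F2_addb eqSS eq_sym; congr _%:R.
by case: (eqVneq l m) => [->|_]; rewrite ?orbF //= gtn_eqF.
Qed.

Lemma dot_chain i j : (i < (2 * g).+1)%N -> (j < (2 * g).+1)%N ->
  dot (chain i) (chain j) = ((i == j.+1) || (j == i.+1))%:R.
Proof.
rewrite -[i]odd_double_half -[j]odd_double_half.
case: (odd i) (odd j) => [] []; rewrite ?add1n ?add0n => hi hj.
- by rewrite !chain_odd dot_alpha (_ : _ || _ = false) //; lia.
- rewrite dot_chain_odd_even; last by lia.
  by congr _%:R; lia.
- rewrite dot_sym dot_chain_odd_even; last by lia.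
  by congr _%:R; lia.
- rewrite (_ : _ || _ = false); last by lia.
  by rewrite !chain_even; case: (i./2) (j./2) => [|m] [|l];
    rewrite !linearDl !linearDr ?linear0l ?linear0r /= !dot_beta !addr0.
Qed.

(** Agreement passes from the chain to the basis: the alphas are chain members, and each beta is
    reached from the previous one through an even member. It then spreads to all sums. *)
Lemma chain_ext c c' :
  c \in spin_structures dot -> c' \in spin_structures dot ->
  (forall i, (i < (2 * g).+1)%N -> c (chain i) = c' (chain i)) -> c = c'.
Proof.
move=> hc hc' cc'.
have c0 : c (0 : V) = c' 0 by rewrite !(@spin0 _ dot).
have cD x y : c x = c' x -> c y = c' y -> c (x + y : V) = c' (x + y).
  by move=> ex ey; rewrite !(@spinD _ dot) // ex ey.
have calpha i : c (alpha i) = c' (alpha i).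
  by rewrite -extend0E -chain_odd cc' //; case: i => i /=; lia.
have cbeta i : c (beta i) = c' (beta i).
  rewrite -extend0E; case: i => m /=; elim: m => [|m IHm] hm.
    by have := cc' 0%N isT; rewrite (chain_even 0) add0r.
  have := cc' m.+1.*2; rewrite chain_even !(@spinD _ dot) // IHm ?(ltnW hm) //.
  by move/(_ ltac:(lia)); rewrite dot_beta !addr0 => /addrI.
have [hbasis _ _ _] := hab.
apply/ffunP => x; pose X := codom alpha ++ codom beta.
have cX v : v \in X -> c v = c' v.
  by rewrite mem_cat => /orP[] /codomP[i ->].
rewrite (coord_basis (X := in_tuple X) hbasis (memvf x)).
elim/big_ind: _ => // i _; rewrite [coord _ _ _]F2E.
by case: (_ != 0); rewrite ?scale0r ?scale1r //; apply/cX/mem_nth.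
Qed.

(** The sum telescopes, since [c] is additive on the mutually orthogonal betas; it ends at [c 0]
    because [extend0 beta g] is the default 0. *)
Lemma sum_spin_chain_even c : c \in spin_structures dot ->
  \sum_(0 <= m < g.+1) c (chain m.*2) = 0.
Proof.
move=> hc.
have partial m : \sum_(0 <= l < m.+1) c (chain l.*2) = c (extend0 beta m).
  elim: m => [|m IHm]; first by rewrite big_nat1 (chain_even 0) add0r.
  rewrite big_nat_recr //= IHm chain_even (@spinD _ dot) // dot_beta addr0.
  by rewrite addrA F2_addrr add0r.
by rewrite partial extend0_ge // (@spin0 _ dot).
Qed.

(** The even chain members pair the points as (2l, 2l+1), with s_(2l) + s_(2l+1) = c(gam_(2l)) + 1;
    over the [g.+1] pairs the values of [c] cancel. *)
Lemma odd_card_labelling c (s : 'I_(2 * g).+2 -> bool) :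
  c \in spin_structures dot -> labelling V (2 * g).+1 chain c s ->
  odd #|[pred i | s i]| = odd g.+1.
Proof.
move=> hc hs; apply: F2_natb_inj; rewrite -!F2_natr.
have partial m : (m <= g.+1)%N ->
    \sum_(0 <= i < m.*2) (s (inord i))%:R =
    \sum_(0 <= l < m) c (chain l.*2) + m%:R :> 'F_2.
  elim: m => [|m IHm] hm; first by rewrite !big_geq // addr0.
  rewrite doubleS !big_nat_recr //= IHm ?(ltnW hm) // hs; last by lia.
  rewrite -natr1 -!addrA; congr (_ + _); rewrite [RHS]addrCA; congr (_ + _).
  by rewrite -[1]/(true%:R) !F2_addb; do 2 case: (s _).
have := partial g.+1 (leqnn _); rewrite sum_spin_chain_even // add0r => <-.
rewrite -sum1_card natr_sum big_mkcond /= doubleS -mul2n big_mkord.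
by apply: eq_bigr => i _; rewrite inE inord_val; case: (s i).
Qed.

End HyperellipticChain.

(** * Counting the orbits *)

Theorem theorem4p2 (k g : nat) (hk : (2 <= k)%N)
    (hg : g = (2 * k - 1)%N \/ g = (2 * k)%N)
    (V : vectType 'F_2) (dot : {symmetric V}) (alpha beta : 'I_g -> V)
    (hab : symplectic_basis dot alpha beta)
    (io : {morphism [set: 'S_(2 * g).+2] >-> {perm finvect_type V}})
    (hio : hyperelliptic_morphism dot alpha beta io) :
  (#|spin_orbits dot io| <= k.+1)%N.
Proof.
have [io_Sp io_first io_last io_alpha io_beta] := hio.
pose gam := chain V g alpha beta.
have io_gam i : (i < (2 * g).+1)%N ->
    io (sigma (2 * g).+1 i.+1) =1 transvection dot (gam i).
  rewrite -[i]odd_double_half; case: (odd i) => hi; rewrite ?add1n ?add0n /gam.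
    have hi' : (i./2 < g)%N by lia.
    rewrite chain_odd extend0_lt.
    by rewrite -doubleS -mul2n; exact: (io_alpha (Ordinal hi')).
  rewrite chain_even; move: hi; rewrite add0n; case: (i./2) => [|m] hm.
    have g_gt0 : (0 < g)%N by lia.
    by rewrite add0r extend0_lt; exact: (io_first (Ordinal g_gt0)).
  have hm' : (m < g)%N by lia.
  rewrite (extend0_lt _ _ _ m hm').
  have [lm|gm] := ltnP m.+1 g.
    rewrite extend0_lt -mul2n.
    exact: (io_beta (Ordinal hm') (Ordinal lm)).
  have eg : m.+1 = g by lia.
  rewrite extend0_ge // addr0 -mul2n eg; exact: (io_last (Ordinal hm')).
(* The index stands outside the implication so that [fin_all_exists] gives a function of every [c],
   with [ord0] as junk value off the spin structures. *)
have small_labelling c : exists i : 'I_k.+1, c \in spin_structures dot ->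
    exists s, labelling V (2 * g).+1 gam c s /\
      (#|[pred j | s j]| + 2 * i = g.+1)%N.
  have [hc|] := boolP (c \in _); last by exists ord0.
  have [s [hs small]] : exists s,
      labelling V (2 * g).+1 gam c s /\ (#|[pred j | s j]| <= g.+1)%N.
    have [s hs] := labelling_exists V (2 * g).+1 gam c.
    have [le|gt] := leqP #|[pred j | s j]| g.+1; first by exists s.
    exists (negb \o s); split; first exact: labelling_compl.
    have := cardC [pred j | s j]; rewrite card_ord.
    rewrite -[X in (_ + X)%N](eq_card (A := [pred j | (negb \o s) j])) //.
    by move: gt; move: #|_| #|_| => a b; lia.
  have par := odd_card_labelling _ _ _ _ _ hab _ _ hc hs.
  (* Both values of [g] give [g.+1./2 = k]; by [par] the halving is exact. *)
  have hi : ((g.+1 - #|[pred j | s j]|)./2 < k.+1)%N by lia.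
  exists (Ordinal hi) => _; exists s; split=> //=; lia.
have [h hP] := fin_all_exists small_labelling.
rewrite -(card_ord k.+1); apply: (leq_card_imset_factor _ _ _ _ h).
move=> c c' hc hc' ehh.
have [s [hs ws]] := hP c hc; have [s' [hs' ws']] := hP c' hc'.
have [|p ->] := labelling_orbit _ _ _ _ _ (dot_chain _ _ _ _ _ hab) io_Sp io_gam
  c c' s s' (chain_ext _ _ _ _ _ hab) hc hc' hs hs'.
  by move: ws'; rewrite -ehh; lia.
by rewrite spin_orbit_act.
Qed.
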